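(* Let $(V,A,\succ)$ be an election, let $0<B\le|A|$, $s>0$, and let $\mathcal{I}$ be a probability distribution on $[0,1]$ with continuous cumulative distribution function. Then there exists an $s$-SLEO with income distribution $\mathcal{I}$ and total budget $B$.
   Context: An election $(V,A,\succ)$: finite nonempty voter set $V$ with $n=|V|$, finite candidate set $A$, and a strict linear order $\succ_v$ on $A$ for each voter $v$. Extend $\succ_v$ to $A\cup\{\emptyset\}$ by placing the outside option $\emptyset$ strictly below every candidate. Given a price vector $p_v\in[0,1]^{A\cup\{\emptyset\}}$ with $p_{v,\emptyset}=0$ and an income $b\ge0$, voter $v$'s demand is the $\succ_v$-maximal element of $\{a\in A\cup\{\emptyset\}: p_{v,a}\le b\}$; the random demand $\mathcal{D}_v(p_v,\mathcal{I})$ is this demand when $b\sim\mathcal{I}$. Given $s>0$, $B>0$ and $\mathcal{I}$ supported on $[0,1]$, an $s$-SLEO $(x,y,p)$ consists of prices $p_v\in[0,1]^{A\cup\{\emptyset\}}$ with $p_{v,\emptyset}=0$ and consumptions $x_v\in[0,1]^{A\cup\{\emptyset\}}$ for each $v\in V$, and $y\in[0,1]^A$, such that: (1) $x_{v,a}=\Pr[\mathcal{D}_v(p_v,\mathcal{I})=a]$ for all $v\in V$, $a\in A\cup\{\emptyset\}$; (2) for all $v\in V$, $a\in A$: $s\cdot x_{v,a}\le y_a$, and if $s\cdot x_{v,a}<y_a$ then $p_{v,a}=0$; (3) $y$ maximizes $\sum_{a\in A}\big(\sum_{v\in V}p_{v,a}\big)z_a$ over all $z\in[0,1]^A$ with $\sum_{a\in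 A}z_a=B$. *)

(* Defs.v *)
From HB Require Import structures.
From mathcomp Require Import all_boot all_order all_algebra.
From mathcomp Require Import all_classical all_reals all_analysis.
Set Implicit Arguments. Unset Strict Implicit. Unset Printing Implicit Defensive.
Import Order.TTheory GRing.Theory Num.Theory.
Local Open Scope classical_set_scope.
Local Open Scope ring_scope.

Definition strict_linear_order (T : finType) (r : rel T) : Prop :=
  [/\ irreflexive r, transitive r & forall a b, a != b -> r a b || r b a].

(* Extension of a voter's order to A ∪ {∅}, with ∅ = None placed strictly
   below every candidate. *)
Definition ext_pref (A : finType) (r : rel A) (o o' : option A) : bool :=
  match o, o' with
  | Some a, Some a' => r a a'
  | Some _, None => true
  | None, _ => false
  end.

Definition is_demand (R : realType) (A : finType) (r : rel A)
    (p : option A -> R) (b : R) (o : option A) : Prop :=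
  p o <= b /\ forall o', p o' <= b -> o' != o -> ext_pref r o o'.

Definition income_cdf (R : realType) (P : probability R R) (t : R) : R :=
  fine (P `]-oo, t]%classic).

Definition is_SLEO (R : realType) (V A : finType) (pref : V -> rel A)
    (s B : R) (P : probability R R)
    (x : V -> option A -> R) (y : A -> R) (p : V -> option A -> R) : Prop :=
  (forall v o, 0 <= p v o <= 1) /\ (forall v, p v None = 0) /\
  (forall v o, 0 <= x v o <= 1) /\ (forall a, 0 <= y a <= 1) /\
      (forall v o, (x v o)%:E = P [set b | is_demand (pref v) (p v) b o]) /\
      (forall v a, s * x v (Some a) <= y a /\
                   (s * x v (Some a) < y a -> p v (Some a) = 0)) /\
      \sum_(a : A) y a = B /\
      (forall z : A -> R, (forall a, 0 <= z a <= 1) -> \sum_(a : A) z a = B ->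
         \sum_(a : A) (\sum_(v : V) p v (Some a)) * z a <=
         \sum_(a : A) (\sum_(v : V) p v (Some a)) * y a).

(* Main.v *)
Require Import Defs.
From HB Require Import structures.
From mathcomp Require Import all_boot zify.

(** Serving voter [v]'s candidates in order of preference, the market clears
    for the supply [y] when the price of [a] is the quantile of
    [max 0 (1 - W / s)], where [W] is the total supply of the candidates that
    [v] weakly prefers to [a].  Replacing the income cdf [F] by
    [(F t + eps * t) / (1 + eps)] makes these prices Lipschitz functions of
    [y].  Let [K a] be the set of supplies [y] such that [y a <= 1] and the
    total price of [a] is maximal up to candidates already supplied to capacity;
    these sets cover the simplex of nonnegative supplies of total [B].  A
    KKM-type theorem then gives a supply which, for every [a] with [y a] not
    negligible, is close to [K a]; this is an approximate equilibrium, and an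
    ultralimit for [eps --> 0] is an exact one.

    The covering theorem comes from Scarf's lemma on dominant sets for a family
    of linear orders, applied to the grid points of the simplex ordered by each
    of their coordinates. *)

Set Implicit Arguments. Unset Strict Implicit. Unset Printing Implicit Defensive.

(** * Scarf's lemma *)

Section Scarf.
Variables (I S : finType) (r : I -> S -> nat).
Hypothesis r_inj : forall i, injective (r i).

(** For nonempty [s]: no point of [S] lies strictly above the minimum of [s] in all the orders at
    once. *)
Definition dominant (s : {set S}) : bool :=
  [forall y, exists i, forall x in s, r i y <= r i x].

Lemma dominantP (s : {set S}) :
  reflect (forall y, exists i, forall x, x \in s -> r i y <= r i x) (dominant s).
Proof.
apply: (iffP forallP) => h y.
  by have /existsP[i /forall_inP hi] := h y; exists i.
by have [i hi] := h y; apply/existsP; exists i; apply/forall_inP.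
Qed.

Lemma dominantS (s t : {set S}) : s \subset t -> dominant t -> dominant s.
Proof.
move=> /subsetP st /dominantP h; apply/dominantP => y.
by have [i hi] := h y; exists i => x /st; apply: hi.
Qed.

(* In the terminology of Scarf's lemma, a dominant set with [#|I|] elements is a
   room and one with [#|I| - 1] elements is a door.  The last hypothesis excludes
   the doors on the boundary.  The map sending an order to the minimum of [t] is
   onto [t], so exactly two orders [i], [j] share their minimum; the two rooms are
   obtained by adding, for [k = i] or [k = j], the [k]-largest point lying above
   the minima of all the other orders. *)
Lemma card_rooms_of_door (t : {set S}) :
    t != set0 -> #|t|.+1 = #|I| -> dominant t ->
    (forall k, exists y, forall l, l != k -> exists2 x, x \in t & r l x < r l y) ->
  #|[set y | (y \notin t) && dominant (y |: t)]| = 2.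
Proof.
move=> /set0Pn[x0 x0t] tI tdom hM.
pose m l := [arg min_(x < x0 in t) r l x].
have mP l : m l \in t /\ forall x, x \in t -> r l (m l) <= r l x.
  by rewrite /m; case: arg_minnP.
have mt l : m l \in t by case: (mP l).
have mmin l x : x \in t -> r l (m l) <= r l x by case: (mP l) => _; apply.
have mdom y : exists l, r l y <= r l (m l).
  by have /dominantP/(_ y)[l hl] := tdom; exists l; apply: hl.
have msurj x : x \in t -> exists l, m l = x.
  move=> xt; have [l hl] := mdom x; exists l; apply: (r_inj (i := l)).
  by apply/eqP; rewrite eqn_leq hl mmin.
have [i [j [ij mij]]] : exists i j, i != j /\ m i = m j.
  have /injectivePn[i [j ij mij]] : ~~ injectiveb m.
    apply/negP => /injectiveP m_inj.
    have : #|m @: [set: I]| <= #|t|.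
      by apply/subset_leq_card/subsetP => _ /imsetP[l _ ->].
    by rewrite card_imset // cardsT -tI ltnn.
  by exists i, j.
pose M k := [set y | [forall l, (l != k) ==> (r l (m l) < r l y)]].
have inM k y : y \in M k -> forall l, l != k -> r l (m l) < r l y.
  by rewrite inE => /forallP h l; have /implyP := h l.
have xP k : exists2 x, x \in M k & forall y, y \in M k -> r k y <= r k x.
  have [y0 hy0] := hM k.
  have y0M : y0 \in M k.
    rewrite inE; apply/forallP => l; apply/implyP => /hy0[x xt].
    by apply: leq_ltn_trans; apply: mmin.
  by case: (arg_maxnP (r k) y0M) => x xM hx; exists x.
have roomP k k' x : k' != k -> m k = m k' -> x \in M k ->
    (forall y, y \in M k -> r k y <= r k x) ->
    (x \notin t) && dominant (x |: t).
  move=> k'k mkk' xM xmax; apply/andP; split.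
    apply/negP => /msurj[l lx].
    have [lk|lk] := eqVneq l k.
      by have := inM _ _ xM _ k'k; rewrite -lx -mkk' lk ltnn.
    by have := inM _ _ xM _ lk; rewrite lx ltnn.
  apply/dominantP => y.
  have [yM|] := boolP (y \in M k).
    exists k => z; rewrite !inE => /predU1P[->|zt]; first exact: xmax.
    apply: leq_trans (xmax _ yM) (leq_trans _ (mmin _ _ zt)).
    have [l hl] := mdom x; have [<-//|lk] := eqVneq l k.
    by have := inM _ _ xM _ lk; rewrite ltnNge hl.
  rewrite inE negb_forall => /existsP[l]; rewrite negb_imply -leqNgt.
  case/andP => lk hl; exists l => z; rewrite !inE => /predU1P[->|zt].
    exact: leq_trans hl (ltnW (inM _ _ xM _ lk)).
  exact: leq_trans hl (mmin _ _ zt).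
have [xi xiM ximax] := xP i; have [xj xjM xjmax] := xP j.
have xij : xi != xj.
  apply/eqP => eqx; have [l] := mdom xi; apply/negP; rewrite -ltnNge.
  have [->|li] := eqVneq l i; last exact: (inM _ _ xiM).
  by rewrite eqx; apply: (inM _ _ xjM).
suff -> : [set y | (y \notin t) && dominant (y |: t)] = [set xi; xj].
  by rewrite cards2 xij.
apply/setP => y; rewrite inE in_set2; apply/idP/orP; last first.
  by case=> /eqP ->; [apply: (roomP i j)|apply: (roomP j i)];
    rewrite // eq_sym.
case/andP => yt /dominantP ydom.
(* Dominance attaches to each point [x] of the room an order [f x] in which [x] is the minimum of
   the room; by cardinality [f] is a bijection onto the orders. *)
have /fin_all_exists[f hf] : forall x : {x | x \in y |: t}, exists l,
    forall z, z \in y |: t -> r l (val x) <= r l z.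
  by move=> x; apply: ydom.
have f_inj : injective f.
  move=> a b fab; apply/val_inj/(r_inj (i := f a))/eqP; rewrite eqn_leq.
  by rewrite hf ?(valP b)// fab hf ?(valP a).
have f_surj l : exists x, f x = l.
  have : l \in codom f.
    apply: (inj_card_onto f_inj).
    by rewrite card_sig cardsU1 yt -tI.
  by case/codomP => x ->; exists x.
have yy : y \in y |: t by rewrite !inE eqxx.
pose k := f (exist _ y yy).
have yM : y \in M k.
  rewrite inE; apply/forallP => l; apply/implyP => lk.
  have [x xl] := f_surj l.
  have xt : val x \in t.
    have := valP x; rewrite !inE => /predU1P[xy|//].
    by case/negP: lk; rewrite -xl; apply/eqP; congr f; apply: val_inj.
  have xm : val x = m l.
    apply: (r_inj (i := l)); apply/eqP; rewrite eqn_leq mmin// andbT -xl hf//.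
    by rewrite !inE mt orbT.
  rewrite ltn_neqAle -xm -xl hf ?yy// andbT xl.
  by apply: contraNneq yt => /r_inj <-.
have ymax x : x \in M k -> r k x <= r k y.
  move=> xM; have [l hl] := ydom x.
  have [<-|lk] := eqVneq l k; first exact: hl.
  have := inM _ _ xM _ lk; rewrite ltnNge hl// !inE mt orbT//.
(* Otherwise the minimum that [i] and [j] share in [t] would be the room's minimum in both orders,
   against the injectivity of [f]. *)
have kij : k = i \/ k = j.
  have [->|ki] := eqVneq k i; first by left.
  have [->|kj] := eqVneq k j; first by right.
  have hm l : l != k -> forall x, f x = l -> val x = m l.
    move=> lk x xl.
    apply: (r_inj (i := l)); apply/eqP; rewrite eqn_leq -{1 2}xl hf; last first.
      by rewrite !inE mt orbT.
    have := valP x; rewrite !inE => /predU1P[xy|]; last exact: mmin.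
    by rewrite xy; apply/ltnW/(inM _ _ yM).
  have [a ai] := f_surj i; have [b bj] := f_surj j.
  case/eqP: ij; rewrite -ai -bj; congr f; apply: val_inj.
  by rewrite (hm i _ a)// 1?eq_sym// mij (hm j)// eq_sym.
have eqk l x : k = l -> x \in M l -> (forall z, z \in M l -> r l z <= r l x) ->
    y = x.
  move=> <- xM xmax; apply: (r_inj (i := k)); apply/eqP.
  by rewrite eqn_leq xmax// ymax.
by case: kij => ke; [left|right]; apply/eqP; apply: eqk ke _ _.
Qed.

(** If all colours occur, each occurs once, and only removing the point of colour [i0] works. If
    not, a facet with colours [[set~ i0]] forces a single repeated colour, and removing either of
    the two points carrying it works; so the count is 0 or 2. *)
Lemma odd_card_facets (c : S -> I) (i0 : I) (s : {set S}) : #|s| = #|I| ->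
  odd #|[set x in s | c @: (s :\ x) == [set~ i0]]| = (c @: s == setT).
Proof.
move=> sI; have [cs|cs] := eqVneq (c @: s) setT.
  have c_inj : {in s &, injective c}.
    by apply/imset_injP; rewrite cs cardsT sI.
  have /imsetP[x xs xi0] : i0 \in c @: s by rewrite cs inE.
  suff -> : [set x in s | c @: (s :\ x) == [set~ i0]] = [set x].
    by rewrite cards1.
  apply/setP => z; rewrite !inE; apply/andP/eqP => [[zs /eqP cz]|->].
    apply: contra_eq cz => zx; apply/eqP => /setP/(_ i0).
    by rewrite !inE eqxx xi0 imset_f// !inE eq_sym zx.
  split=> //; apply/eqP/setP => i; rewrite !inE.
  apply/imsetP/idP => [[y]|ii0].
    rewrite !inE => /andP[/eqP yx ys] ->; apply/eqP; rewrite xi0.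
    by move=> /(c_inj _ _ ys xs).
  have /imsetP[y ys yi] : i \in c @: s by rewrite cs inE.
  exists y => //; rewrite !inE ys andbT; apply: contraNneq ii0 => yx.
  by rewrite yi xi0 yx.
case: (set_0Vmem [set x in s | c @: (s :\ x) == [set~ i0]]) => [->|[x]].
  by rewrite cards0.
rewrite inE => /andP[xs /eqP cx].
have c_inj : {in s :\ x &, injective c}.
  apply/imset_injP; rewrite cx cardsC1 -sI.
  by rewrite (cardsD1 x s) xs.
have cxi0 : c x != i0.
  apply: contraNneq cs => cxi0; apply/eqP/setP => i; rewrite inE.
  have [->|ii0] := eqVneq i i0; first by rewrite -cxi0 imset_f.
  have : i \in [set~ i0] by rewrite !inE.
  rewrite -cx => /imsetP[y]; rewrite !inE => /andP[_ ys] ->.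
  exact: imset_f.
have /imsetP[x' x's cxx'] : c x \in c @: (s :\ x) by rewrite cx !inE.
have [x'x x's'] : x' != x /\ x' \in s by apply/andP; move: x's; rewrite !inE.
suff -> : [set x in s | c @: (s :\ x) == [set~ i0]] = [set x; x'].
  by rewrite cards2 eq_sym x'x.
apply/setP => z; rewrite inE in_set2; apply/andP/orP.
  case=> zs /eqP cz; have [|zx] := eqVneq z x; first by left.
  right; apply/eqP.
  have zsx : z \in s :\ x by rewrite !inE zx.
  have : c z \in c @: (s :\ z) by rewrite cz -cx imset_f.
  case/imsetP => w; rewrite !inE => /andP[wz ws] czw.
  have [wx|wx] := eqVneq w x.
    by apply: c_inj => //; rewrite czw wx.
  by case/eqP: wz; apply: c_inj => //; rewrite !inE wx.
case=> /eqP ->; first by rewrite cx.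
split=> //; rewrite -cx; apply/eqP/setP => i; apply/imsetP/imsetP => -[y].
  rewrite !inE => /andP[yx' ys] ->; have [->|yx] := eqVneq y x.
    by exists x'.
  by exists y; rewrite // !inE yx.
rewrite !inE => /andP[yx ys] ->; have [->|yx'] := eqVneq y x'.
  by exists x; rewrite // !inE eq_sym x'x.
by exists y; rewrite // !inE yx'.
Qed.


(* The [e i] are the slack points at the boundary.  Double counting modulo 2 of
   the pairs (door with colours [[set~ i0]], point completing it to a room): the
   doors contribute 1, from the boundary door, and the rooms contribute the number
   of rooms with all colours. *)
Lemma scarf (e : I -> S) (c : S -> I) (x0 : S) :
    (forall i y, r i (e i) <= r i y) ->
    (forall i j y, j != i -> (forall k, y != e k) -> r i y < r i (e j)) ->
    cancel e c -> (forall k, x0 != e k) ->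
  exists s : {set S}, [/\ dominant s, #|s| = #|I| & c @: s = setT].
Proof.
move=> e_min e_max ce x0e; pose i0 := c x0.
have e_inj := can_inj ce.
have Ipos : 0 < #|I| by apply/card_gt0P; exists i0.
have notdom y i : (forall k, y != e k) -> r i y <= r i (e i) -> False.
  move=> ye yi; case/eqP: (ye i); apply: (r_inj (i := i)); apply/eqP.
  by rewrite eqn_leq yi e_min.
pose rooms (t : {set S}) := [set y | (y \notin t) && dominant (y |: t)].
pose door (t : {set S}) := (#|t|.+1 == #|I|) && (c @: t == [set~ i0]).
pose t0 := e @: [set~ i0].
have c_bd l : c @: (e @: [set~ l]) = [set~ l].
  rewrite -imset_comp -[RHS]imset_id; apply: eq_imset => i /=.
  exact: ce.
have card_bd l : #|e @: [set~ l]|.+1 = #|I|.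
  by rewrite card_imset// cardsC1 prednK.
have t0door : door t0 by rewrite /door card_bd c_bd !eqxx.
(* The boundary door is completed only by the [i0]-largest non-slack point, a non-dominant door by
   none, and a dominant door other than [t0] by exactly two points. *)
have odd_rooms t : door t -> odd #|rooms t| = (t == t0).
  case/andP => /eqP tI /eqP ct; have [->|tt0] := eqVneq t t0.
    have xmP : [forall k, x0 != e k] by apply/forallP.
    case: (arg_maxnP (P := fun x => [forall k, x != e k]) (r i0) xmP).
    move=> xm /forallP xme xmmax'.
    have xmmax z : [forall k, z != e k] -> r i0 z <= r i0 xm by apply: xmmax'.
    suff -> : rooms t0 = [set xm] by rewrite cards1.
    apply/setP => y; rewrite !inE; apply/andP/eqP => [[yt0 /dominantP ydom]|->].
      have ynd k : y != e k.
        have [->|ki0] := eqVneq k i0; last first.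
          apply: contraNneq yt0 => ->; apply: imset_f; by rewrite !inE.
        apply/eqP => yi0; have [i hi] := ydom x0.
        apply: (notdom x0 i) => //; apply: hi; rewrite !inE yi0.
        have [->|ii0] := eqVneq i i0; first by rewrite eqxx.
        by rewrite imset_f ?orbT// !inE.
      apply: (r_inj (i := i0)); apply/eqP; rewrite eqn_leq.
      rewrite xmmax /=; last exact/forallP.
      have [i hi] := ydom xm; have [ii0|ii0] := eqVneq i i0.
        by rewrite -ii0 hi// !inE eqxx.
      case: (notdom xm i) => //; apply: hi; rewrite !inE.
      by rewrite imset_f ?orbT// !inE.
    split; first by apply/negP => /imsetP[k _ /eqP]; apply/negP.
    apply/dominantP => z; have [zP|] := boolP [forall k, z != e k].
      exists i0 => x; rewrite !inE => /predU1P[->|/imsetP[j jC ->]].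
        exact: xmmax.
      by rewrite ltnW// e_max//; [move: jC; rewrite !inE|apply/forallP].
    by rewrite negb_forall => /existsP[k]; rewrite negbK => /eqP ->; exists k.
  have [tdom|tdom] := boolP (dominant t); last first.
    rewrite (_ : rooms t = set0) ?cards0//; apply/setP => y; rewrite !inE.
    by apply: contraNF tdom => /andP[_]; apply: dominantS; apply: subsetUr.
  rewrite card_rooms_of_door//.
    apply: contraNneq tt0 => t_0; rewrite t_0 eq_sym -cards_eq0 -eqSS.
    by rewrite card_bd -tI t_0 cards0.
  move=> k; exists (e k) => l lk.
  have [/existsP[x /andP[xt xl]]|] := boolP [exists x, (x \in t) && (r l x < r l (e k))].
    by exists x.
  rewrite negb_exists => /forallP h.
  have tle x : x \in t -> r l (e k) <= r l x.
    by move=> xt; have := h x; rewrite xt -leqNgt.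
  (* If all of [t] lies above [e k] in the order [l], then [t] contains only slack points other than
     [e l]; its colours then force [l = i0], hence [t = t0]. *)
  have tbd : t = e @: [set~ l].
    apply/eqP; rewrite eqEcard -ltnS card_bd tI leqnn andbT.
    apply/subsetP => x xt.
    have [/forallP xe|] := boolP [forall j, x != e j].
      by have := tle x xt; rewrite leqNgt e_max// eq_sym.
    rewrite negb_forall => /existsP[j]; rewrite negbK => /eqP xj.
    rewrite xj imset_f// !inE; apply/eqP => jl; case/eqP: lk.
    apply/e_inj/(r_inj (i := l))/eqP; rewrite eqn_leq e_min.
    by have := tle _ xt; rewrite xj jl.
  case/eqP: tt0; rewrite tbd; congr (_ @: _).
  by rewrite -ct tbd c_bd.
pose Q := [set q : {set S} * S | door q.1 & q.2 \in rooms q.1].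
have oddQ : odd #|Q|.
  rewrite -sum1_card (partition_big fst door) /=; last first.
    by move=> q; rewrite inE => /andP[].
  rewrite (bigD1 t0)//= oddD.
  have inner t : door t -> \sum_(q in Q | q.1 == t) 1 = #|rooms t|.
    move=> td; rewrite sum1dep_card -[RHS](card_imset _ (f := pair t)); last first.
      by move=> a b [].
    apply: eq_card => -[t' y]; rewrite !inE /=; apply/andP/imsetP.
      by case=> /andP[_ yt'] /eqP <-; exists y; rewrite ?inE.
    by case=> y' y't [-> ->]; move: y't; rewrite !inE eqxx td => ->.
  rewrite inner// odd_rooms// eqxx /=.
  rewrite (big_morph odd oddD (erefl _)) big1// => t /andP[td tt0].
  by rewrite inner// odd_rooms// (negbTE tt0).
have : odd (\sum_(s | dominant s && (#|s| == #|I|)) (c @: s == setT)).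
  apply: etrans oddQ; rewrite -sum1_card; apply/esym.
  rewrite (partition_big (fun q => q.2 |: q.1)
    (fun s => dominant s && (#|s| == #|I|))) /=; last first.
    move=> [t y]; rewrite !inE /= => /andP[/andP[tI _] /andP[yt ->]].
    by rewrite cardsU1 yt.
  rewrite !(big_morph odd oddD (erefl _)); apply: eq_bigr => s /andP[sdom /eqP sI].
  rewrite oddb -(odd_card_facets c i0 sI) sum1dep_card; congr odd.
  rewrite -[RHS](card_imset _ (f := fun x => (s :\ x, x))); last by move=> a b [].
  apply: eq_card => -[t y]; rewrite !inE /=; apply/andP/imsetP; last first.
    case=> x; rewrite !inE => /andP[xs cx] [-> ->].
    rewrite setD1K// eqxx sdom !inE eqxx /door cx !andbT.
    by rewrite -sI (cardsD1 x s) xs.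
  case=> /andP[/andP[tI ct] /andP[yt _]] /eqP <-; exists y.
    by rewrite !inE eqxx setU1K.
  by rewrite setU1K.
case: (pickP (fun s => dominant s && (#|s| == #|I|) && (c @: s == setT))).
  by move=> s /andP[/andP[sdom /eqP sI] /eqP cs] _; exists s.
by move=> h; rewrite big1// => s sP; have := h s; rewrite sP /= => ->.
Qed.

End Scarf.

(** * Scarf's lemma on the integer grid of the simplex *)

(** Scarf's lemma is applied to the grid points together with one slack point [inl b] of colour [b]
    per coordinate. [C] collects the coordinates whose slack point is absent from the dominant set,
    so each colour in [C] is carried by a grid point [x a]; [m] records the coordinatewise minima of
    these points. *)
Lemma scarf_grid (A : finType) (N : nat) (c : {ffun A -> 'I_N.+1} -> A) :
    (0 < #|A|)%N ->
  exists (C : {set A}) (x : A -> {ffun A -> 'I_N.+1}) (m : A -> nat),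
    [/\ C != set0, forall i, i \notin C -> m i = 0%N &
        forall a, a \in C -> [/\ (\sum_i x a i = N)%N, c (x a) = a &
          forall i, (m i <= x a i <= m i + #|A|)%N]].
Proof.
move=> /card_gt0P[a1 _].
pose T : finType := {x : {ffun A -> 'I_N.+1} | (\sum_i x i == N)%N}.
pose k := #|T|.
(* Scaling by [k] and adding the rank breaks ties between equal coordinates. The slack point [inl i]
   is the bottom of its own order, and in every other order it lies above all grid points. *)
pose r (i : A) (z : A + T) : nat := match z with
  | inl b => if b == i then 0 else N.+1 * k + (enum_rank b).+1
  | inr x => (val x i * k + enum_rank x).+1 end.
have r_lt i (x : T) : (r i (inr x) <= N.+1 * k)%N.
  rewrite /= -addnS; have := ltn_ord (val x i); have := ltn_ord (enum_rank x).
  rewrite -/k => h1 h2; apply: leq_trans (_ : (val x i).+1 * k <= _)%N.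
    by rewrite mulSn addnC leq_add2r.
  by rewrite leq_mul2r h2 orbT.
have r_inj i : injective (r i).
  have er_inj (U : finType) (a b : U) :
      nat_of_ord (enum_rank a) = enum_rank b -> a = b.
    by move=> /val_inj/enum_rank_inj.
  move=> [b|x] [b'|x'].
  - rewrite /=; case: eqP => [->|_]; case: eqP => [->|_] //; try lia.
    by move=> /addnI[/er_inj ->].
  - have := r_lt i x'; rewrite /=; case: eqP => _; lia.
  - have := r_lt i x; rewrite /=; case: eqP => _; lia.
  - rewrite /= => -[] /(congr1 (modn^~ k)).
    by rewrite !modnMDl !modn_small// => /er_inj ->.
pose c' (z : A + T) : A := match z with inl b => b | inr x => c (val x) end.
have gridP (y : A -> nat) : (\sum_i y i = N)%N ->
    exists x : T, forall i, nat_of_ord (val x i) = y i.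
  move=> yN.
  have yle i : (y i < N.+1)%N by rewrite ltnS -yN (bigD1 i)//= leq_addr.
  pose x : {ffun A -> 'I_N.+1} := [ffun i => Ordinal (yle i)].
  have xN : (\sum_i x i == N)%N.
    by rewrite -[X in _ == X]yN; apply/eqP/eq_bigr => i _; rewrite ffunE.
  by exists (exist _ x xN) => i; rewrite /= ffunE.
have [x0 _] : exists x : T, forall i, nat_of_ord (val x i) = (if i == a1 then N else 0).
  by apply: gridP; rewrite -big_mkcond big_pred1_eq.
have [s [/dominantP sdom _ cs]] : exists s : {set A + T},
    [/\ dominant r s, #|s| = #|A| & c' @: s = [set: A]].
  apply: (@scarf _ _ r r_inj inl c' (inr x0)) => //.
  - by move=> i y; rewrite /= eqxx.
  - move=> i j [b _ /(_ b)|x ji _]; first by rewrite eqxx.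
    by rewrite (leq_ltn_trans (r_lt i x))//= (negbTE ji) addnS ltnS leq_addr.
pose C := [set a : A | inl a \notin s].
have /fin_all_exists[x xP] : forall a, exists x : T,
    a \in C -> inr x \in s /\ c (val x) = a.
  move=> a; have [aC|_] := boolP (a \in C); last by exists x0.
  have : a \in c' @: s by rewrite cs inE.
  case/imsetP => -[b bs /= ab|z zs ->]; last by exists z.
  by move: aC; rewrite inE ab bs.
have dom (y : T) : exists2 i, i \in C &
    forall a, a \in C -> (val y i <= val (x a) i)%N.
  have [i hi] := sdom (inr y); exists i.
    by rewrite inE; apply/negP => /hi; rewrite /= eqxx.
  move=> a aC; have /hi /= := (xP _ aC).1; rewrite ltnS.
  rewrite leqNgt; case: (ltnP (val (x a) i) (val y i)) => //.
  move=> lt; case/negP; have := ltn_ord (enum_rank (x a)); rewrite -/k => h.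
  apply: leq_trans (_ : (val (x a) i).+1 * k <= _)%N.
    by rewrite mulSn addnC ltn_add2r.
  by apply: leq_trans (leq_addr _ _); rewrite leq_mul2r lt orbT.
have [a0 a0C _] := dom x0.
pose m i := if i \in C then val (x [arg min_(a < a0 in C) val (x a) i]) i : nat
  else 0%N.
have mle a i : a \in C -> (m i <= val (x a) i)%N.
  by rewrite /m => aC; case: ifP => // _; case: arg_minnP => // a' _; apply.
(* Otherwise some grid point exceeds all the minima, against dominance. *)
have mN : (N < \sum_(i in C) (m i).+1)%N.
  rewrite ltnNge; apply/negP => le.
  pose y i := ((if i \in C then (m i).+1 else 0) +
    (if i == a0 then N - \sum_(i in C) (m i).+1 else 0))%N.
  have [|y' y'E] := gridP y.
    by rewrite big_split/= -!big_mkcond big_pred1_eq/= addnC subnK.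
  have [i iC hi] := dom y'.
  have : exists2 a, a \in C & m i = val (x a) i.
    by rewrite /m iC; case: arg_minnP => // a aC _; exists a.
  by case=> a /hi; rewrite y'E /y iC => h ma; move: h; rewrite ma; lia.
exists C, (fun a => val (x a)), m; split.
- by apply/set0Pn; exists a0.
- by move=> i; rewrite /m => /negbTE ->.
move=> a aC; have [_ cxa] := xP _ aC; have /eqP xN := valP (x a).
split=> // i; rewrite mle//=.
(* By [mN] the total excess of [x a] over the minima is at most [#|C|]; as no term is negative, this
   bounds every single coordinate. *)
have mC : (\sum_(i in C) (m i).+1 = \sum_i m i + #|C|)%N.
  rewrite (eq_bigr (fun i => m i + 1)%N) => [|j _]; last by rewrite addn1.
  rewrite big_split/= sum1_card; congr addn.
  by rewrite big_mkcond; apply: eq_bigr => j _; case: ifP => // jC; rewrite /m jC.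
have sumD : (\sum_i (val (x a) i - m i) + \sum_i m i = N)%N.
  by rewrite -big_split/= -[RHS]xN; apply: eq_bigr => j _; rewrite subnK// mle.
have le1 : (\sum_i (val (x a) i - m i) <= #|C|)%N.
  by rewrite -(leq_add2r (\sum_i m i)) sumD addnC -mC ltnW.
rewrite -leq_subLR; apply: leq_trans (leq_trans le1 (max_card _)).
by rewrite [leqRHS](bigD1 i)//= leq_addr.
Qed.

From mathcomp Require Import all_order all_algebra ring lra.
From mathcomp Require Import all_classical all_reals all_analysis.
Import Order.TTheory GRing.Theory Num.Theory.
Import numFieldNormedType.Exports.
Local Open Scope classical_set_scope.
Local Open Scope ring_scope.

(** * Approximate equilibria *)

Definition simplex (R : realType) (A : finType) (B : R) (y : A -> R) : Prop :=
  (forall a, 0 <= y a) /\ \sum_a y a = B.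

(** Colour each grid point by a set [K a] containing it. The points given by [scarf_grid] are close
    together and carry all the colours in [C], while coordinates outside [C] are small. *)
Lemma kkm_approx (R : realType) (A : finType) (B : R)
    (K : A -> (A -> R) -> Prop) :
    (0 < #|A|)%N -> 0 < B -> (forall y, simplex B y -> exists a, K a y) ->
  forall d : R, 0 < d -> exists2 y, simplex B y & forall a, y a <= d \/
    exists x, [/\ simplex B x, K a x & forall b, `|x b - y b| <= d].
Proof.
move=> A0 B0 Kcov d d0.
have [a1 _] : exists a : A, a \in A by apply/card_gt0P.
(* The grid is fine enough for [#|A|] steps of length [B / N] to stay within [d]. *)
pose N := (Num.bound (B * #|A|%:R / d)).+1.
have N0 : 0 < N%:R :> R by rewrite ltr0n.
have BN : B / N%:R * #|A|%:R <= d.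
  rewrite mulrAC ler_pdivrMr// [d * _]mulrC -ler_pdivrMr//.
  apply: le_trans (ltW (archi_boundP _)) _; last by rewrite ler_nat.
  by rewrite !mulr_ge0// ?invr_ge0// ltW.
have BN0 : 0 < B / N%:R by rewrite divr_gt0.
pose pt (f : {ffun A -> 'I_N.+1}) (a : A) : R := B / N%:R * (f a)%:R.
have ptP (f : {ffun A -> 'I_N.+1}) : (\sum_a f a = N)%N -> simplex B (pt f).
  move=> fN; split=> [a|]; first by rewrite mulr_ge0// ltW.
  by rewrite -mulr_sumr -natr_sum fN divfK// gt_eqF.
have /choice[c cP] : forall f : {ffun A -> 'I_N.+1}, exists a, (\sum_i f i = N)%N -> K a (pt f).
  move=> f; have [fN|fN] := pselect (\sum_i f i = N)%N.
    by have [a Ka] := Kcov _ (ptP _ fN); exists a.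
  by exists a1 => /fN.
have [C [x [m [C0 mC xP]]]] := scarf_grid c A0.
have /set0Pn[a0 a0C] := C0.
have [x0N cx0 mx0] := xP _ a0C.
(* Any index in [C] would do, since all these points lie in one box of side [#|A|] grid steps. *)
exists (pt (x a0)); first exact: ptP.
move=> a; have [aC|aC] := boolP (a \in C).
  right; have [xN cx mx] := xP _ aC.
  exists (pt (x a)); split; [exact: ptP|by have := cP _ xN; rewrite cx|].
  move=> b; rewrite /pt -mulrBr normrM gtr0_norm//.
  apply: le_trans BN; rewrite ler_pM2l//.
  have /andP[h1 h2] := mx b; have /andP[h3 h4] := mx0 b.
  rewrite ler_distl; apply/andP; split.
    by rewrite lerBlDr -natrD ler_nat; apply: leq_trans h4 _; rewrite leq_add2r.
  by rewrite -natrD ler_nat; apply: leq_trans h2 _; rewrite leq_add2r.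
left; rewrite /pt (le_trans _ BN)// ler_pM2l// ler_nat.
by have /andP[_] := mx0 a; rewrite mC.
Qed.

(** Intermediate value theorem: [F t + eps * t] runs from 0 to [1 + eps] on the unit interval. *)
Lemma regularized_quantile (R : realType) (F : R -> R) (eps : R) :
    0 < eps -> continuous F -> F 0 = 0 -> F 1 = 1 ->
  exists q : R -> R, forall u, 0 <= u <= 1 ->
    0 <= q u <= 1 /\ F (q u) + eps * q u = (1 + eps) * u.
Proof.
move=> e0 Fc F0 F1.
suff /choice[q qP] : forall u : R, exists t : R, 0 <= u <= 1 ->
    0 <= t <= 1 /\ F t + eps * t = (1 + eps) * u by exists q.
move=> u; have [u01|] := pselect (0 <= u <= 1); last by exists 0.
pose G t := F t + eps * t.
have Gc : {within `[0, 1], continuous G}.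
  apply: continuous_subspaceT => t; apply: cvgD; first exact: Fc.
  by apply: cvgM; [exact: cvg_cst|exact: cvg_id].
have [|t] := @IVT _ G 0 1 ((1 + eps) * u) ler01 Gc.
  rewrite /G F0 F1 mulr0 mulr1 addr0 ge_min le_max; apply/andP; split.
    by apply/orP; left; nra.
  by apply/orP; right; nra.
by rewrite in_itv/= => t01 Gt; exists t.
Qed.

(** As [F] is nondecreasing, [F t + eps * t] has slope at least [eps], so its inverse is
    Lipschitz. *)
Lemma regularized_lipschitz (R : realType) (F : R -> R) (eps a b u v : R) :
    {homo F : x y / x <= y} -> 0 < eps ->
    F a + eps * a = (1 + eps) * u -> F b + eps * b = (1 + eps) * v ->
  eps * `|a - b| <= (1 + eps) * `|u - v|.
Proof.
move=> Fmono e0 ha hb.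
wlog ab : a b u v ha hb / a <= b.
  move=> H; have [/H|/ltW/H] := leP a b; first exact.
  by rewrite distrC (distrC u); apply.
have Fab := Fmono _ _ ab.
rewrite distrC ger0_norm ?subr_ge0// distrC.
apply: le_trans (_ : (1 + eps) * (v - u) <= _); first by nra.
by rewrite ler_pM2l ?ler_norm//; lra.
Qed.

Lemma regularized_mono (R : realType) (F : R -> R) (eps a b u v : R) :
    {homo F : x y / x <= y} -> 0 < eps ->
    F a + eps * a = (1 + eps) * u -> F b + eps * b = (1 + eps) * v ->
  u <= v -> a <= b.
Proof.
move=> Fmono e0 ha hb uv; rewrite leNgt; apply/negP => ba.
have := Fmono _ _ (ltW ba); nra.
Qed.

Definition weak_upper_sum (R : realType) (A : finType) (r : rel A) (y : A -> R)
  (a : A) : R := \sum_(b | (b == a) || r b a) y b.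

(** The share of the voter's income mass left unserved after [a] and all better candidates; it is
    the value that the income cdf must take at the price of [a]. *)
Definition residual (R : realType) (A : finType) (s : R) (r : rel A)
  (y : A -> R) (a : A) : R := Num.max 0 (1 - weak_upper_sum r y a / s).

Lemma residual_bounds (R : realType) (A : finType) (s : R) (r : rel A)
    (y : A -> R) (a : A) :
  0 < s -> (forall a, 0 <= y a) -> 0 <= residual s r y a <= 1.
Proof.
move=> s0 y0; rewrite /residual le_max lexx/= ge_max ler01/= gerBl.
by rewrite divr_ge0 ?sumr_ge0// ltW.
Qed.

Lemma residual_lipschitz (R : realType) (A : finType) (s : R) (r : rel A)
    (x y : A -> R) (d : R) (a : A) :
  0 < s -> (forall b, `|x b - y b| <= d) ->
  `|residual s r x a - residual s r y a| <= #|A|%:R * d / s.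
Proof.
move=> s0 xy.
have d0 : 0 <= d by apply: le_trans (xy a).
have : `|weak_upper_sum r x a / s - weak_upper_sum r y a / s| <= #|A|%:R * d / s.
  rewrite -mulrBl normrM (gtr0_norm (x := s^-1)) ?invr_gt0//.
  rewrite ler_pM2r ?invr_gt0// /weak_upper_sum -sumrB.
  apply: le_trans (ler_norm_sum _ _ _) _.
  apply: le_trans (_ : \sum_(b : A) d <= _); last first.
    by rewrite sumr_const mulr_natl.
  rewrite big_mkcond/=; apply: ler_sum => b _; case: ifP => // _.
rewrite /residual; move: (_ / s) (_ / s) (_ / s) => S T L.
rewrite !ler_norml => /andP[h1 h2].
by rewrite /Num.max; do 2 case: ltP => ?; apply/andP; split; lra.
Qed.

Lemma approx_SLEO (R : realType) (V A : finType) (pref : V -> rel A)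
    (s B eps : R) (F : R -> R) :
    {homo F : x y / x <= y} -> continuous F -> F 0 = 0 -> F 1 = 1 ->
    0 < B -> B <= #|A|%:R -> 0 < s -> 0 < eps ->
  exists (y : A -> R) (p : V -> A -> R),
    [/\ simplex B y, forall v a, 0 <= p v a <= 1,
      forall v a, F (p v a) + eps * p v a = (1 + eps) * residual s (pref v) y a &
      forall a, y a <= eps \/ y a <= 1 + eps /\ forall b, y b < 1 - eps ->
        \sum_v p v b <= \sum_v p v a + eps].
Proof.
move=> Fmono Fc F0 F1 B0 BA s0 e0.
have A0 : (0 < #|A|)%N by rewrite -(ltr_nat R) (lt_le_trans B0).
have [q qP] := regularized_quantile e0 Fc F0 F1.
pose p y v a := q (residual s (pref v) y a).
have pP y v a : simplex B y -> 0 <= p y v a <= 1 /\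
    F (p y v a) + eps * p y v a = (1 + eps) * residual s (pref v) y a.
  by move=> [y0 _]; apply/qP/residual_bounds.
pose Pr y a := \sum_v p y v a.
pose K a y := y a <= 1 /\ forall b, y b < 1 -> Pr y b <= Pr y a.
have Kcov y : simplex B y -> exists a, K a y.
  move=> [y0 yB].
  have [b0 b01|yge] := pickP (fun b => y b < 1).
    case: (@Order.TotalTheory.arg_maxP _ _ _ b0 (fun b => y b < 1) (Pr y) b01) => a a1 amax.
    by exists a; split=> [|b /amax//]; apply: ltW.
  have {}yge b : 1 <= y b by rewrite leNgt yge.
  have [a1 _] : exists a : A, a \in A by apply/card_gt0P.
  exists a1; split=> [|b]; last by rewrite ltNge yge.
  (* All supplies are at least 1 and their total is at most [#|A|], so each of them equals 1. *)
  have : \sum_a (y a - 1) <= 0.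
    by rewrite sumrB yB sumr_const subr_le0.
  rewrite (bigD1 a1)//= -[y a1 <= 1]subr_le0.
  by apply: le_trans; rewrite lerDl sumr_ge0// => b _; rewrite subr_ge0.
(* [L] is a Lipschitz constant of the total prices in the sup norm. In [(2 * L + 1) * d = eps], the
   summand [2 * L * d] pays for moving two total prices and [d] for moving a supply. *)
pose L := #|V|%:R * ((1 + eps) / eps * (#|A|%:R / s)).
have L0 : 0 <= L by rewrite !mulr_ge0// ?invr_ge0; lra.
pose d := eps / (2 * L + 1).
have d0 : 0 < d by rewrite divr_gt0//; lra.
have de : (2 * L + 1) * d = eps by rewrite mulrC divfK// gt_eqF//; lra.
have Ld : 0 <= L * d by rewrite mulr_ge0// ltW.
have [y yB yP] := kkm_approx A0 B0 Kcov d0.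
exists y, (p y); split=> //; try by move=> v a; case: (pP y v a yB).
move=> a; case: (yP a) => [ya|[x [xB [xa1 xmax] xy]]].
  by left; lra.
have Prxy c : `|Pr x c - Pr y c| <= L * d.
  rewrite /Pr -sumrB; apply: le_trans (ler_norm_sum _ _ _) _.
  have -> : L * d = \sum_(v : V) ((1 + eps) / eps * (#|A|%:R / s) * d).
    by rewrite sumr_const -[RHS]mulr_natl /L; ring.
  apply: ler_sum => v _.
  have [_ hx] := pP x v c xB; have [_ hy] := pP y v c yB.
  have := regularized_lipschitz Fmono e0 hx hy.
  rewrite -ler_pdivlMl// => /le_trans; apply.
  have -> : (1 + eps) / eps * (#|A|%:R / s) * d =
    eps^-1 * ((1 + eps) * (#|A|%:R * d / s)) by ring.
  rewrite ler_pM2l ?invr_gt0// ler_pM2l; last by lra.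
  exact: residual_lipschitz.
right; split.
  by have := xy a; rewrite ler_norml; lra.
move=> b yb.
have xb : x b < 1 by have := xy b; rewrite ler_norml; lra.
have := xmax b xb; have := Prxy a; have := Prxy b; rewrite !ler_norml.
by rewrite /Pr; lra.
Qed.

(** * Passage to the limit *)

(** Compactness of the segment gives a cluster point, and an ultrafilter converges to its cluster
    points. One ultrafilter thus makes all supplies and prices converge simultaneously. *)
Lemma bounded_ultra_cvg (R : realType) (T : Type) (U : set_system T)
    (u : T -> R) (a b : R) :
    UltraFilter U -> (forall n, a <= u n <= b) ->
  exists l : R, u n @[n --> U] --> l.
Proof.
move=> UU uab; have PU := @ultra_proper _ _ UU.
have [|l [_ lcl]] := @segment_compact R a b (u @ U) _.
  by rewrite nbhs_simpl/=; apply: filterE => n; rewrite /= in_itv/=.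
exists l => N lN; rewrite nbhs_simpl/=.
have [//|UN] := in_ultra_setVsetC (u @^-1` N) UU.
by have [z [/=]] := lcl (~` N) N UN lN.
Qed.

Lemma cvg_residual (R : realType) (A : finType) (s : R) (r : rel A) (T : Type)
    (U : set_system T) (y : T -> A -> R) (l : A -> R) (a : A) :
    Filter U -> (forall a, y n a @[n --> U] --> l a) ->
  residual s r (y n) a @[n --> U] --> residual s r l a.
Proof.
move=> FU yl; rewrite /residual.
under eq_fun do rewrite maxr_absE; rewrite maxr_absE.
have wl : 1 - weak_upper_sum r (y n) a / s @[n --> U] -->
    1 - weak_upper_sum r l a / s.
  apply: cvgB; first exact: cvg_cst.
  apply: cvgM; last exact: cvg_cst.
  by apply: cvg_big => //; exact: add_continuous.
apply: cvgM; last exact: cvg_cst.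
apply: cvgD; first by apply: cvgD => //; exact: cvg_cst.
by apply: cvg_norm; apply: cvgB => //; exact: cvg_cst.
Qed.

(** Where [F] is flat, [F (p v a)] does not determine the price. The vanishing and the monotonicity
    of prices are therefore taken from the regularized equations before the limit, not from the
    limiting equation. *)
Lemma limit_SLEO (R : realType) (V A : finType) (pref : V -> rel A)
    (s B : R) (F : R -> R) :
    (forall v, transitive (pref v)) ->
    {homo F : x y / x <= y} -> continuous F -> F 0 = 0 -> F 1 = 1 ->
    0 < B -> B <= #|A|%:R -> 0 < s ->
  exists (y : A -> R) (p : V -> A -> R),
    [/\ simplex B y /\ forall a, y a <= 1, forall v a, 0 <= p v a <= 1,
      forall v a, F (p v a) = residual s (pref v) y a,
      forall v a, s < weak_upper_sum (pref v) y a -> p v a = 0 &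
      (forall v a b, pref v a b -> p v b <= p v a) /\
      forall a b, 0 < y a -> y b < 1 -> \sum_v p v b <= \sum_v p v a].
Proof.
move=> ptr Fmono Fc F0 F1 B0 BA s0.
pose eps : nat -> R := harmonic.
have eps0 n : 0 < eps n by exact: harmonic_gt0.
have /choice[y /choice[p /all_and4[yB p01 pF opt]]] := fun n =>
  approx_SLEO pref Fmono Fc F0 F1 B0 BA s0 (eps0 n).
have [U [UU ooU]] := ultraFilterLemma eventually_filter.
have PU := @ultra_proper _ _ UU.
have eps_cvg : eps n @[n --> U] --> (0 : R).
  by move=> N /cvg_harmonic/ooU.
have yb n a : 0 <= y n a <= B.
  have [yn0 yn] := yB n; rewrite yn0/= -yn (bigD1 a)//= lerDl.
  by rewrite sumr_ge0.
have /choice[yl yC] : forall a, exists l : R, y n a @[n --> U] --> l.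
  by move=> a; apply: bounded_ultra_cvg => n; apply: yb.
have /choice[pl pC] : forall va : V * A, exists l : R, p n va.1 va.2 @[n --> U] --> l.
  by move=> [v a]; apply: bounded_ultra_cvg => n; apply: p01.
have wC v a : weak_upper_sum (pref v) (y n) a @[n --> U] --> weak_upper_sum (pref v) yl a.
  by apply: cvg_big => //; exact: add_continuous.
have PC a : \sum_v p n v a @[n --> U] --> \sum_v pl (v, a).
  apply: cvg_big => // [|v _]; first exact: add_continuous.
  exact: (pC (v, a)).
have unique (u : nat -> R) (k l : R) : u n @[n --> U] --> k -> u n @[n --> U] --> l -> k = l.
  by move=> uk ul; apply: cvg_unique uk ul; exact: Rhausdorff.
have le_lim (f g : nat -> R) (k l : R) : f n @[n --> U] --> k ->
    g n @[n --> U] --> l -> (\forall n \near U, f n <= g n) -> k <= l.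
  move=> fk gl fg; rewrite -subr_ge0; apply: (cvgr_to_ge (cvgB gl fk)).
  by apply: filterS fg => n; rewrite -subr_ge0.
exists yl, (fun v a => pl (v, a)); split.
- split; first split.
  + move=> a; apply: (cvgr_to_ge (yC a)); apply: filterE => n.
    by have /andP[] := yb n a.
  + apply: (unique (fun n => \sum_a y n a)).
      by apply: cvg_big => //; exact: add_continuous.
    apply: cvg_near_cst; apply: filterE => n; by case: (yB n).
  + move=> a; rewrite leNgt; apply/negP => ya.
    have le1 : yl a <= 1 + 0.
      apply: (le_lim _ (fun n => 1 + eps n) _ _ (yC a)).
        by apply: cvgD => //; exact: cvg_cst.
      near=> n; rewrite /=.
      case: (opt n a) => [yle|[//]]; apply: le_trans yle _; lra.
    by move: le1; rewrite addr0 leNgt ya.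
- move=> v a; apply/andP; split.
    by apply: (cvgr_to_ge (pC (v, a))); apply: filterE => n; have /andP[] := p01 n v a.
  by apply: (cvgr_to_le (pC (v, a))); apply: filterE => n; have /andP[] := p01 n v a.
- move=> v a.
  apply: (unique (fun n => F (p n v a))); first exact: continuous_cvg (Fc _) (pC (v, a)).
  have E n : F (p n v a) = (1 + eps n) * residual s (pref v) (y n) a - eps n * p n v a.
    by rewrite -pF addrK.
  under eq_fun do rewrite E.
  have -> : residual s (pref v) yl a =
    (1 + 0) * residual s (pref v) yl a - 0 * pl (v, a) by ring.
  apply: cvgB; last by apply: cvgM => //; exact: (pC (v, a)).
  apply: cvgM; last exact: cvg_residual.
  by apply: cvgD => //; exact: cvg_cst.
(* The strict inequality holds eventually along [U]; there the equation reads [F p + eps * p = 0],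
   so the approximate price is already 0. *)
- move=> v a sw; apply: (unique (fun n => p n v a)); first exact: (pC (v, a)).
  apply: cvg_near_cst; near=> n.
  have sn : s < weak_upper_sum (pref v) (y n) a by near: n; apply: cvgr_gt sw; exact: wC.
  have res0 : residual s (pref v) (y n) a = 0.
    by rewrite /residual max_l// subr_le0 ler_pdivlMr// mul1r ltW.
  have := pF n v a; rewrite res0 mulr0 => h.
  have /andP[p0 _] := p01 n v a.
  have := Fmono _ _ p0; rewrite F0 => Fp0.
  have := eps0 n; nra.
split.
- move=> v a b ab; apply: (le_lim _ _ _ _ (pC (v, b)) (pC (v, a))).
  near=> n; apply: (regularized_mono Fmono (eps0 n) (pF n v b) (pF n v a)).
  rewrite /residual; apply: le_max2 => //; rewrite lerD2l lerN2 ler_pM2r ?invr_gt0//.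
  rewrite /weak_upper_sum; have [yn0 _] := yB n.
  rewrite big_mkcond [leRHS]big_mkcond; apply: ler_sum => c _.
  case: ifP => [ca|_]; last by case: ifP.
  rewrite ifT//; case/predU1P: ca => [->|ca]; first by rewrite ab orbT.
  by rewrite (ptr v _ _ _ ca ab) orbT.
move=> a b ya yb1.
(* Eventually the supply of [a] is not negligible and that of [b] is below [1 - eps n], which is the
   case of [opt] that compares total prices. *)
have near_a : \forall n \near U, 0 < y n a - eps n.
  by apply: (cvgr_gt _ (cvgB (yC a) eps_cvg)); rewrite subr0.
have near_b : \forall n \near U, y n b + eps n < 1.
  by apply: (cvgr_lt _ (cvgD (yC b) eps_cvg)); rewrite addr0.
have le0 : \sum_v pl (v, b) <= \sum_v pl (v, a) + 0.
  apply: (le_lim _ (fun n => \sum_v p n v a + eps n) _ _ (PC b)).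
    exact: cvgD.
  near=> n; rewrite /=.
  have yan : eps n < y n a by rewrite -subr_gt0; near: n.
  have ybn : y n b < 1 - eps n by rewrite ltrBrDr; near: n.
  case: (opt n a) => [|[_ /(_ b ybn)//]]; by rewrite leNgt yan.
by rewrite addr0 in le0.
Unshelve. all: by end_near.
Qed.

(** * Demand probabilities *)

Lemma fine_probability_le (R : realType) (P : probability R R) (X Y : set R) :
  measurable X -> measurable Y -> X `<=` Y -> fine (P X) <= fine (P Y).
Proof.
move=> mX mY XY; apply: fine_le; [exact: fin_num_measure|exact: fin_num_measure|].
by apply: le_measure => //; rewrite inE.
Qed.

Lemma income_cdf_mono (R : realType) (P : probability R R) :
  {homo income_cdf P : x y / x <= y}.
Proof.
move=> x y xy; apply: fine_probability_le => // z.
by rewrite /= !in_itv/= => zx; apply: le_trans zx xy.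
Qed.

(** Incomes below 0 have no mass, and continuity excludes an atom at 0. *)
Lemma income_cdf0 (R : realType) (P : probability R R) :
  P `[0, 1]%classic = 1%E -> continuous (income_cdf P) -> income_cdf P 0 = 0.
Proof.
move=> P01 Fc; apply/eqP; rewrite eq_le; apply/andP; split; last first.
  by apply: fine_ge0; apply: measure_ge0.
have Fl : income_cdf P t @[t --> 0^'-] --> income_cdf P 0.
  exact: cvg_at_left_filter (Fc 0).
apply: (cvgr_to_le Fl); near=> t.
have t0 : t < 0 by near: t; exact: nbhs_left_lt.
have -> : 0 = fine (P (~` `[0, 1]%classic)).
  by rewrite probability_setC// P01 subee.
apply: fine_probability_le => //; first exact: measurableC.
move=> z; rewrite /= !in_itv/= => zt /andP[z0 _].
by have := le_lt_trans zt t0; rewrite ltNge z0.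
Unshelve. all: by end_near.
Qed.

Lemma income_cdf1 (R : realType) (P : probability R R) :
  P `[0, 1]%classic = 1%E -> income_cdf P 1 = 1.
Proof.
move=> P01; apply/eqP; rewrite eq_le; apply/andP; split.
  rewrite -lee_fin fineK ?probability_le1//; exact: fin_num_measure.
apply: le_trans (_ : fine (P `[0, 1]%classic) <= _); first by rewrite P01.
apply: fine_probability_le => // z; rewrite /= !in_itv/=.
by case/andP.
Qed.

Lemma probability_ray (R : realType) (P : probability R R) (b : R) :
  continuous (income_cdf P) -> fine (P `]-oo, b[%classic) = income_cdf P b.
Proof.
move=> Fc; apply/eqP; rewrite eq_le; apply/andP; split.
  apply: fine_probability_le => // z; rewrite /= !in_itv/=; exact: ltW.
have Fl : income_cdf P t @[t --> b^'-] --> income_cdf P b.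
  exact: cvg_at_left_filter (Fc b).
apply: (cvgr_to_le Fl); near=> t.
have tb : t < b by near: t; exact: nbhs_left_lt.
apply: fine_probability_le => // z; rewrite /= !in_itv/= => zt.
exact: le_lt_trans tb.
Unshelve. all: by end_near.
Qed.

Lemma probability_co (R : realType) (P : probability R R) (a b : R) :
  continuous (income_cdf P) -> a <= b ->
  fine (P `[a, b[%classic) = income_cdf P b - income_cdf P a.
Proof.
move=> Fc ab.
have -> : `[a, b[%classic = `]-oo, b[ `\` `]-oo, a[.
  apply/seteqP; split=> z; rewrite /= !in_itv/=.
    by move=> /andP[az zb]; split=> //; apply/negP; rewrite -leNgt.
  by case=> -> /negP; rewrite -leNgt => ->.
rewrite measureD//; last first.
  by rewrite ltey_eq fin_num_measure.
rewrite (_ : _ `&` _ = `]-oo, a[%classic).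
  by rewrite fineB ?fin_num_measure// !probability_ray.
apply/seteqP; split=> z; rewrite /= !in_itv/=; first by case.
by move=> za; split=> //; apply: lt_le_trans ab.
Qed.

Lemma probability_cy (R : realType) (P : probability R R) (a : R) :
  continuous (income_cdf P) ->
  fine (P `[a, +oo[%classic) = 1 - income_cdf P a.
Proof.
move=> Fc.
have -> : `[a, +oo[%classic = ~` `]-oo, a[.
  by apply/seteqP; split=> z; rewrite /= !in_itv/= ?andbT leNgt => /negP.
rewrite probability_setC// fineB ?fin_num_measure//.
by rewrite probability_ray.
Qed.

(** The set is an interval: between two of its incomes, the lower one guarantees that [o] is
    affordable and the upper one that nothing better is. *)
Lemma measurable_demand (R : realType) (A : finType) (r : rel A)
    (p : option A -> R) (o : option A) :
  measurable [set b | is_demand r p b o].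
Proof.
apply: measurable_realfun.is_interval_measurable => b1 b2 [h1 _] [_ h2] b.
case/andP=> b1b bb2; split=> [|o' po']; first exact: le_trans b1b.
by apply: h2; apply: le_trans bb2.
Qed.

Definition strict_upper_sum (R : realType) (A : finType) (r : rel A)
  (y : A -> R) (a : A) : R := \sum_(b | r b a) y b.

Lemma weak_upper_sumE (R : realType) (A : finType) (r : rel A) (y : A -> R) a :
  irreflexive r -> weak_upper_sum r y a = y a + strict_upper_sum r y a.
Proof.
move=> irr; rewrite /weak_upper_sum (bigD1 a) ?eqxx//=; congr (_ + _).
apply: eq_bigl => b; have [->|_] := eqVneq b a; first by rewrite irr.
by rewrite andbT.
Qed.

(** Among the candidates above [a], take one with the most candidates above it. The strict upper set
    of [a] is then the weak upper set of [c], so the residual of [c] measures the incomes below the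
    point where demand leaves [a]. *)
Lemma immediate_predecessor (A : finType) (r : rel A) (a c0 : A) :
    strict_linear_order r -> r c0 a ->
  exists2 c, r c a & forall d, r d a = (d == c) || r d c.
Proof.
move=> [irr tr tot] c0a.
case: (@arg_maxnP _ c0 (fun c => r c a) (fun c => #|[pred d | r d c]|) c0a).
move=> c ca cmax; exists c => // d; apply/idP/idP => [da|]; last first.
  by case/predU1P => [->//|dc]; apply: tr dc ca.
have [//|dc/=] := eqVneq d c.
case/orP: (tot _ _ dc) => // cd.
have := cmax _ da; rewrite /= leqNgt => /negP[].
apply: proper_card; apply/properP; split.
  by apply/fintype.subsetP => e; rewrite !inE => ec; apply: tr ec cd.
by exists c; rewrite !inE// irr.
Qed.

Lemma demand_someE (R : realType) (A : finType) (r : rel A)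
    (p : option A -> R) (a : A) : strict_linear_order r ->
  [set b | is_demand r p b (Some a)] =
  [set b | p (Some a) <= b /\ forall c, r c a -> b < p (Some c)].
Proof.
move=> [irr tr tot]; apply/seteqP; split=> b /= [pa h]; split=> //.
  move=> c ca; rewrite ltNge; apply/negP => pc.
  have cna : Some c != Some a by apply: contraTneq ca => -[->]; rewrite irr.
  by have := tr _ _ _ ca (h _ pc cna); rewrite irr.
case=> [c|//] pc ca /=.
have /tot : c != a by apply: contraNneq ca => ->.
by case/orP => // /h; rewrite ltNge pc.
Qed.

(** By monotonicity of prices, [a] is demanded exactly at incomes from its own price up to that of
    its immediate predecessor, or without upper bound if [a] is the favourite; the mass is a
    difference of cdf values. *)
Lemma probability_demand (R : realType) (A : finType) (r : rel A)
    (P : probability R R) (p : option A -> R) (y : A -> R) (s : R) (a : A) :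
    strict_linear_order r -> continuous (income_cdf P) ->
    (forall a, income_cdf P (p (Some a)) = residual s r y a) ->
    (forall a b, r a b -> p (Some b) <= p (Some a)) ->
  fine (P [set b | is_demand r p b (Some a)]) =
    Num.max 0 (1 - strict_upper_sum r y a / s) -
    Num.max 0 (1 - weak_upper_sum r y a / s).
Proof.
move=> rlin Fc Fp pmono; rewrite demand_someE//.
have [c0 c0a|none] := pickP (fun c => r c a).
  have [c ca cP] := immediate_predecessor rlin c0a.
  rewrite (_ : [set b | _] = `[p (Some a), p (Some c)[%classic).
    rewrite probability_co//; last exact: pmono.
    rewrite !Fp /residual; congr (Num.max _ (_ - _ / _) - _).
    by apply: eq_bigl => d; rewrite cP.
  apply/seteqP; split=> b; rewrite /= in_itv/=.
    by case=> -> h; rewrite h.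
  move=> /andP[-> bc]; split=> // d; rewrite cP => /predU1P[->//|dc].
  by apply: lt_le_trans bc _; apply: pmono.
rewrite (_ : [set b | _] = `[p (Some a), +oo[%classic).
  rewrite probability_cy// Fp /residual /strict_upper_sum big_pred0//.
  by rewrite mul0r subr0 [X in _ = X - _]max_r.
apply/seteqP; split=> b; rewrite /= in_itv/= andbT; first by case.
by move=> ->; split=> // c; rewrite none.
Qed.

(** * Optimality of the supply and the exact equilibrium *)

(** Fractional knapsack: a threshold [l] separates the weights of supplied candidates from those of
    candidates below capacity, so every term [(w a - l) * (z a - y a)] is at most 0. *)
Lemma budget_maximizer (R : realType) (A : finType) (w y z : A -> R) :
    (forall a, 0 <= z a <= 1) -> \sum_a z a = \sum_a y a ->
    (forall a, 0 <= w a) -> (forall a, y a <= 1) ->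
    (forall a b, 0 < y a -> y b < 1 -> w b <= w a) ->
  \sum_a w a * z a <= \sum_a w a * y a.
Proof.
move=> z01 zy w0 y1 wopt.
have [l lP] : exists l, forall a, (0 < y a -> l <= w a) /\ (y a < 1 -> w a <= l).
  have [b0 b01|none] := pickP (fun b => y b < 1); last first.
    (* With every candidate at capacity, only a lower bound on the weights is required, and 0 is
       one. *)
    by exists 0 => a; split=> //; rewrite none.
  case: (@Order.TotalTheory.arg_maxP _ _ _ b0 (fun b => y b < 1) w b01).
  move=> b b1 bmax; exists (w b) => a; split=> [/wopt|]; first exact.
  exact: bmax.
rewrite -subr_le0 -sumrB.
apply: le_trans (_ : \sum_a l * (z a - y a) <= 0); last first.
  by rewrite -mulr_sumr sumrB zy subrr mulr0.
apply: ler_sum => a _; have [h1 h2] := lP a; have /andP[z0 z1] := z01 a.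
have [zya|yza] := leP (z a) (y a).
  have [ya|ya] := ltP 0 (y a); first by have := h1 ya; nra.
  have -> : z a = y a by lra.
  by rewrite !subrr mulr0.
by have := h2 (lt_le_trans yza z1); nra.
Qed.

Theorem mainTheorem6 (R : realType) (V A : finType) (pref : V -> rel A)
    (s B : R) (P : probability R R) :
  (0 < #|V|)%N ->
  (forall v, strict_linear_order (pref v)) ->
  0 < B -> B <= #|A|%:R -> 0 < s ->
  P `[0, 1]%classic = 1%E ->
  continuous (income_cdf P) ->
  exists (x : V -> option A -> R) (y : A -> R) (p : V -> option A -> R),
    is_SLEO pref s B P x y p.
Proof.
move=> _ plin B0 BA s0 P01 Fc.
have ptr v : transitive (pref v) by case: (plin v).
have [y [p [[[y0 yB] y1] p01 pF pz [pmono popt]]]] :=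
  limit_SLEO ptr (@income_cdf_mono R P) Fc (income_cdf0 P01 Fc) (income_cdf1 P01)
    B0 BA s0.
pose p' v o := if o is Some a then p v a else 0.
pose D v o := [set b | is_demand (pref v) (p' v) b o].
have mD v o : measurable (D v o) by exact: measurable_demand.
have fD v o : P (D v o) \is a fin_num by exact: fin_num_measure.
exists (fun v o => fine (P (D v o))), y, p'.
have xE v a := @probability_demand _ _ _ _ (p' v) y s a (plin v) Fc (pF v) (pmono v).
(* With [u = y a / s] and [t] the scaled supply of better candidates, the share [x] is at most [u],
   and it falls short only if [u + t > 1], which is the case where [pz] makes the price vanish. *)
have shareP v a (x := Num.max 0 (1 - strict_upper_sum (pref v) y a / s) -
    Num.max 0 (1 - weak_upper_sum (pref v) y a / s)) :
    (s * x < y a -> s < weak_upper_sum (pref v) y a) /\ s * x <= y a.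
  rewrite /x weak_upper_sumE; last by case: (plin v).
  rewrite mulrDl; set t := _ / s; set u := y a / s.
  have -> : y a = s * u by rewrite mulrC divfK// gt_eqF.
  have u0 : 0 <= u by rewrite divr_ge0// ltW.
  have -> : strict_upper_sum (pref v) y a = s * t by rewrite mulrC divfK// gt_eqF.
  rewrite ltr_pM2l// ler_pM2l// -mulrDr ltr_pMr//.
  by rewrite /Num.max; case: (ltP 0 (1 - t)) => ?; case: (ltP 0 (1 - (u + t))) => ?;
    split=> [?|]; lra.
do !split => //.
- by move=> v [a|]; [exact: p01|rewrite /= lexx ler01].
- move=> v o; rewrite fine_ge0//= -lee_fin fineK//.
  exact: probability_le1.
- by move=> a; rewrite y0 y1.
- by move=> v o; rewrite fineK.
- by rewrite xE; case: (shareP v a).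
- rewrite xE => lt; apply: pz; have [h _] := shareP v a; exact: h.
- move=> z z01 zB; apply: budget_maximizer => //; first by rewrite zB yB.
  by move=> a; apply: sumr_ge0 => v _; have /andP[] := p01 v a.
Qed.
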